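(* Let $E$ be a real Banach space, let $F$ be a real Hilbert space, let $\varepsilon\ge0$, and let $f\colon E\to F$ be an $\varepsilon$-nearisometry with $f(0)=0$. Then there is a linear isometry $T\colon E\to F$ such that $\sup\{|T(x)-P(f(x))|:x\in E\}\le2\varepsilon$, where $P\colon F\to TE$ is the orthogonal projection. Hence $E$ is isomorphic to a Hilbert space. If $f$ is surjective or if $\dim E=\dim F<\infty$, then $T$ is surjective and $\sup\{|T(x)-f(x)|:x\in E\}\le2\varepsilon$.
   Context: Norms are denoted $|\cdot|$. For $\varepsilon\ge0$, a map $f\colon E\to F$ is an $\varepsilon$-nearisometry if $|x-y|-\varepsilon\le|f(x)-f(y)|\le|x-y|+\varepsilon$ for all $x,y\in E$. An isometry is a distance-preserving map, not assumed surjective. $TE$ denotes the image of $T$. *)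

(* Defs.v *)
From mathcomp Require Import all_boot all_order all_algebra.
From mathcomp Require Import sesquilinear.
From mathcomp Require Import all_classical all_reals all_analysis.

Set Implicit Arguments.
Unset Strict Implicit.
Unset Printing Implicit Defensive.

Import Order.TTheory GRing.Theory Num.Theory.
Import numFieldNormedType.Exports.

Local Open Scope classical_set_scope.
Local Open Scope ring_scope.

(* No continuity is required of [f]. *)
Definition nearisometry (R : realType) (E F : normedModType R)
    (eps : R) (f : E -> F) : Prop :=
  forall x y : E,
    `|x - y| - eps <= `|f x - f y| /\ `|f x - f y| <= `|x - y| + eps.

(* Distance-preserving; not assumed surjective.  The library constant
   [sesquilinear.isometry] concerns forms, not norms. *)
Definition isometric_map (R : realType) (E F : normedModType R)
    (f : E -> F) : Prop :=
  forall x y : E, `|f x - f y| = `|x - y|.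

Definition surjective (A B : Type) (f : A -> B) : Prop :=
  forall y : B, exists x : A, f x = y.

(* A real Hilbert space is a complete normed module [F] over [R] with a real
   inner product [dot : {dot F for idfun}] (a symmetric positive definite
   bilinear form) that induces its norm. *)
Definition induces_norm (R : realType) (F : normedModType R)
    (dot : {dot F for idfun}) : Prop :=
  forall x : F, `|x| ^+ 2 = dot x x.

(* For a linear subspace [V], such a [P] is unique; it exists in a Hilbert
   space exactly when [V] is closed. *)
Definition orthogonal_projection (R : realType) (F : normedModType R)
    (dot : {dot F for idfun}) (V : set F) (P : F -> F) : Prop :=
  forall y : F, V (P y) /\ (forall v : F, V v -> dot (y - P y) v = 0).

(* Isometric linear isomorphism with some Hilbert space; in particular a linear
   homeomorphism onto that space. *)
Definition isomorphic_to_hilbert (R : realType) (E : normedModType R) : Prop :=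
  exists (H : completeNormedModType R) (dot : {dot H for idfun})
         (J : {linear E -> H}),
    [/\ induces_norm dot, isometric_map J & bijective J].

(* [V] has a basis of [n] vectors. *)
Definition has_dim (R : realType) (V : lmodType R) (n : nat) : Prop :=
  exists b : 'I_n -> V,
    (forall c : 'I_n -> R, \sum_(i < n) c i *: b i = 0 -> forall i, c i = 0) /\
    (forall x : V, exists c : 'I_n -> R, x = \sum_(i < n) c i *: b i).

(* Main.v *)
Require Import Defs.
From HB Require Import structures.
From mathcomp Require Import all_boot all_order all_algebra.
From mathcomp Require Import sesquilinear.
From mathcomp Require Import all_classical all_reals all_analysis.
From mathcomp Require Import ring lra.

Import Order.TTheory GRing.Theory Num.Theory.
Import numFieldNormedType.Exports.

Local Open Scope classical_set_scope.
Local Open Scope ring_scope.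

(** Rescaling [f] by larger and larger factors produces the isometry: the
claim is that [T x = lim f (n x) / n] exists.  For [s <= t] the three vectors
[0], [f (s x)], [f (t x)] have mutual distances within [eps] of those of the
collinear points [0], [s x], [t x]; since the norm of [F] comes from an inner
product, such a nearly degenerate triangle is thin, and
[|f (s x) / s - f (t x) / t|^2] is of order [1 / s]
([nearisometry_sqnorm_scale]).  The limit preserves distances because the
error [eps] is divided by [n], and a distance-preserving map fixing [0] into an
inner product space is linear ([isometric_map_linear]).

To compare [T] with [f] one looks at points from infinity.  If [a_n / n] tends
to [v], then [|a_n| - |a_n - b|] tends to [dot v b / |v|]
([cvg_busemann]): seen from far away in the direction [v], distances measure
only the component along [v].  Apply this once to [a_n = f (n u)], [b = f x]
and once to [a_n = T (n u)], [b = T x].  As [f] changes each of the two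
distances by at most [eps] and [T] by nothing, the two limits differ by at most
[2 * eps], so the component of [f x - T x] along any vector [T u] is at most
[2 * eps] in absolute value ([dot_asymptotic_cone_defect]).  The vector
[P (f x) - T x] lies in the range of [T] and has the same components there,
whence the bound.

If [f] is onto and [v] is orthogonal to the range of [T], then every multiple
[f x = n v] has projection [0], so [|x| = |T x| <= 2 * eps] and
[n |v| <= 3 * eps] for all [n], which forces [v = 0].  In the case of equal
finite dimensions [T] is onto because it is injective.  Either way [P] is the
identity.  Finally, [E] is itself a Hilbert space for the inner product pulled
back along [T]. *)

(** * Inner products *)

Section InnerProduct.
Context {R : realType} {F : normedModType R} {dot : {dot F for idfun}}.

Lemma dotC x y : dot x y = dot y x.
Proof. by rewrite hermC expr0 mul1r. Qed.

Lemma dotZl a x y : dot (a *: x) y = a * dot x y.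
Proof. exact: linearZl_LR. Qed.

Lemma dotZr a x y : dot x (a *: y) = a * dot x y.
Proof. exact: linearZr_LR. Qed.

Lemma dotDl x y z : dot (x + y) z = dot x z + dot y z.
Proof. exact: linearDl. Qed.

Lemma dotDr x y z : dot z (x + y) = dot z x + dot z y.
Proof. exact: linearDr. Qed.

Lemma dotBl x y z : dot (x - y) z = dot x z - dot y z.
Proof. exact: linearBl. Qed.

Hypothesis hdot : induces_norm dot.

Lemma sqnormD x y : `|x + y| ^+ 2 = `|x| ^+ 2 + 2 * dot x y + `|y| ^+ 2.
Proof.
by rewrite !hdot dotDl !dotDr (dotC y x); ring.
Qed.

Lemma sqnormB x y : `|x - y| ^+ 2 = `|x| ^+ 2 - 2 * dot x y + `|y| ^+ 2.
Proof. by rewrite sqnormD normrN -scaleN1r dotZr mulN1r mulrN. Qed.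

Lemma dot_polar x y : dot x y = (`|x| ^+ 2 + `|y| ^+ 2 - `|x - y| ^+ 2) / 2.
Proof. by rewrite sqnormB; lra. Qed.

Lemma cvg_dotl (u : nat -> F) l b : u @ \oo --> l ->
  dot (u n) b @[n --> \oo] --> dot l b.
Proof.
move=> ul; under eq_fun do rewrite dot_polar.
rewrite dot_polar; apply: cvgMl.
have sq (v : nat -> F) k : v @ \oo --> k ->
    `|v n| ^+ 2 @[n --> \oo] --> `|k| ^+ 2.
  by move=> vk; rewrite expr2; under eq_fun do rewrite expr2;
    apply: cvgM; apply: cvg_norm.
apply: cvgB; last by apply: sq; apply: cvgB => //; exact: cvg_cst.
by apply: cvgD; [exact: sq|exact: cvg_cst].
Qed.

End InnerProduct.

(** * Limits of sequences *)

Lemma cvgn_sqnorm_bound {R : realType} {E : completeNormedModType R}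
    (u : nat -> E) (K : R) :
  (forall n m, (n <= m)%N -> `|u n - u m| ^+ 2 <= K * harmonic n) ->
  cvgn u.
Proof.
move=> uK; apply/cauchy_cvgP/cauchy_exP => e e0.
have K0 : K * harmonic n @[n --> \oo] --> 0.
  by rewrite -(mulr0 K); apply: cvgMr; exact: cvg_harmonic.
have e20 : 0 < e ^+ 2 by rewrite exprn_gt0.
have [N _ /(_ N (leqnn N)) /= KN] := cvgr_lt 0 K0 (e ^+ 2) e20.
exists (u N), N => //= n Nn; rewrite -ball_normE /ball_/=.
rewrite -(@ltr_pXn2r _ 2) ?nnegrE ?normr_ge0 ?(ltW e0)//.
exact: le_lt_trans (uK _ _ Nn) KN.
Qed.

(** The Busemann function of the direction [v] is linear in an inner product
space: [|a| - |a - b|] is [(2 * dot a b - |b|^2) / (|a| + |a - b|)], and after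
dividing numerator and denominator by [n] both converge. *)
Lemma cvg_busemann {R : realType} {F : normedModType R}
    {dot : {dot F for idfun}} (hdot : induces_norm dot)
    (a : nat -> F) (v b : F) : v != 0 ->
  harmonic n *: a n @[n --> \oo] --> v ->
  `|a n| - `|a n - b| @[n --> \oo] --> dot v b / `|v|.
Proof.
move=> v0 av; set h := @harmonic R; set c := fun n => h n *: a n.
have h0 n : 0 < h n by exact: harmonic_gt0.
have cb : c n - h n *: b @[n --> \oo] --> v.
  rewrite -[X in _ --> X]subr0 -(scale0r b); apply: cvgB => //.
  by apply: cvgZr_tmp; exact: cvg_harmonic.
have -> : dot v b / `|v| = (2 * dot v b - 0 * `|b| ^+ 2) / (`|v| + `|v|).
  by field; rewrite -mulr2n mulrn_eq0 /= normr_eq0 v0.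
have quot : (2 * dot (c n) b - h n * `|b| ^+ 2)
     * (`|c n| + `|c n - h n *: b|)^-1 @[n --> \oo]
     --> (2 * dot v b - 0 * `|b| ^+ 2) / (`|v| + `|v|).
  apply: cvgM.
    apply: cvgB; first by apply: cvgMr; exact: (cvg_dotl hdot).
    by apply: cvgMl; exact: cvg_harmonic.
  apply: cvgV; first by rewrite -mulr2n mulrn_eq0 /= normr_eq0.
  by apply: cvgD; exact: cvg_norm.
have pos : \forall n \near \oo, 0 < `|c n|.
  by apply: (cvgr_gt _ (cvg_norm av)); rewrite normr_gt0.
apply: cvg_trans quot; apply: near_eq_cvg.
near=> n.
have cn : 0 < `|c n| by near: n.
have cE : `|c n| = h n * `|a n| by rewrite normrZ gtr0_norm.
have cbE : `|c n - h n *: b| = h n * `|a n - b|.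
  by rewrite -scalerBr normrZ gtr0_norm.
have S1 : 0 < h n * `|a n| + h n * `|a n - b|.
  by rewrite -cE ltr_pwDl// mulr_ge0 // ltW.
rewrite cE cbE dotZl.
apply: (@mulIf _ (h n * `|a n| + h n * `|a n - b|)); first by rewrite gt_eqF.
rewrite divfK ?gt_eqF//.
have := sqnormB hdot (a n) b.
have -> : (`|a n| - `|a n - b|) * (h n * `|a n| + h n * `|a n - b|)
  = h n * (`|a n| ^+ 2 - `|a n - b| ^+ 2) by ring.
by move=> ->; ring.
Unshelve. all: by end_near.
Qed.

(** * The linear isometry attached to a nearisometry *)

Lemma isometric_map_norm {R : realType} {E F : normedModType R} (g : E -> F) :
  isometric_map g -> g 0 = 0 -> forall x, `|g x| = `|x|.
Proof. by move=> gi g0 x; rewrite -[g x]subr0 -g0 gi subr0. Qed.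

(** Inner products of values are determined by distances, so [g (a *: x)] and
[a *: g x] can be compared by expanding the square of their difference.
Additivity is the preservation of midpoints: [E] need not be an inner product
space, but the parallelogram identity in [F] shows that [g m] is the only point
at distance [|x - y| / 2] from both [g x] and [g y]. *)
Lemma isometric_map_linear {R : realType} {E F : normedModType R}
    {dot : {dot F for idfun}} (hdot : induces_norm dot) (g : E -> F) :
  isometric_map g -> g 0 = 0 -> linear g.
Proof.
move=> gi g0.
have gn := isometric_map_norm _ gi g0.
have gZ a x : g (a *: x) = a *: g x.
  apply/eqP; rewrite -subr_eq0 -normr_eq0 -sqrf_eq0.
  rewrite (sqnormB hdot) dotZr (dot_polar hdot) gi !gn.
  rewrite -[X in _ - `|_ - X| ^+ 2]scale1r -scalerBl !normrZ gn !exprMn.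
  by rewrite !real_normK ?num_real//; apply/eqP; field.
have gmid x y : g x + g y = 2 *: g (2^-1 *: (x + y)).
  set m := 2^-1 *: (x + y).
  have half z : z = 2^-1 *: z + 2^-1 *: z :> E.
    rewrite -scalerDl (_ : _ + _ = 1) ?scale1r//; by field.
  have xm : `|g m - g x| = `|x - y| / 2.
    rewrite gi {1}(half x) /m scalerDr opprD.
    rewrite [2^-1 *: x + _]addrC addrA addrK -scalerBr normrZ distrC.
    by rewrite gtr0_norm ?invr_gt0// mulrC.
  have my : `|g m - g y| = `|x - y| / 2.
    rewrite gi [in X in m - X](half y) /m scalerDr opprD addrA addrK.
    by rewrite -scalerBr normrZ gtr0_norm ?invr_gt0// mulrC.
  have xy : `|(g m - g x) - (g m - g y)| = `|x - y|.
    by rewrite opprB addrC addrA subrK -normrN opprB gi.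
  apply/eqP; rewrite eq_sym -subr_eq0 -normr_eq0 -sqrf_eq0.
  have -> : 2 *: g m - (g x + g y) = (g m - g x) + (g m - g y).
    by rewrite scaler_nat mulr2n opprD addrACA.
  by rewrite (sqnormD hdot) (dot_polar hdot) xy xm my; apply/eqP; field.
move=> a x y.
by rewrite -gZ gmid gZ scalerA divff// scale1r.
Qed.

(** With [r = |x|], expand the square and replace the inner product by the three
squared distances between [0], [f (s x)], [f (t x)].  These squares enter with
coefficients of known sign, so each can be replaced by its extreme value; the
terms in [r ^+ 2] then cancel, because [0], [s x], [t x] are collinear. *)
Lemma nearisometry_sqnorm_scale {R : realType} {E F : normedModType R}
    {dot : {dot F for idfun}} (hdot : induces_norm dot) (eps : R)
    (f : E -> F) (x : E) (s t : R) :
  0 <= eps -> nearisometry eps f -> f 0 = 0 -> 1 <= s -> s <= t ->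
  `|s^-1 *: f (s *: x) - t^-1 *: f (t *: x)| ^+ 2
    <= (6 * eps * `|x| + eps ^+ 2) * s^-1.
Proof.
move=> e0 hf f0 s1 st.
have s0 : 0 < s by apply: lt_le_trans s1.
have t0 : 0 < t by apply: lt_le_trans st.
have r0 := normr_ge0 x; set r := `|x| in r0 *.
have bnd k : 0 < k -> k * r - eps <= `|f (k *: x)| <= k * r + eps.
  move=> k0; have := hf (k *: x) 0; rewrite f0 !subr0 normrZ gtr0_norm//.
  by case=> -> ->.
have hA : `|f (s *: x)| ^+ 2 <= (s * r + eps) ^+ 2.
  by have /andP[_ ?] := bnd _ s0; rewrite lerXn2r// nnegrE ?addr_ge0// ?mulr_ge0// ltW.
(* The [eps ^+ 2] of [(t * r - eps) ^+ 2] is dropped so that the bound also holds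
   when [t * r < eps]. *)
have hB : (t * r) ^+ 2 - 2 * (t * r) * eps <= `|f (t *: x)| ^+ 2.
  have /andP[hl _] := bnd _ t0; have n0 := normr_ge0 (f (t *: x)).
  have : 0 <= t * r by rewrite mulr_ge0// ltW.
  move: (t * r) `|f (t *: x)| hl n0 => k n hl n0 k0; have [ke|ke] := leP eps k.
    have : (k - eps) ^+ 2 <= n ^+ 2 by rewrite lerXn2r// nnegrE ?subr_ge0.
    by have := sqr_ge0 eps; rewrite sqrrB; lra.
  have : k * (k - eps) <= 0 by rewrite mulr_ge0_le0// subr_le0 ltW.
  have : 0 <= k * eps by rewrite mulr_ge0.
  by have := sqr_ge0 n; lra.
have hD : `|f (s *: x) - f (t *: x)| ^+ 2 <= ((t - s) * r + eps) ^+ 2.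
  have [_] := hf (s *: x) (t *: x).
  rewrite -scalerBl normrZ (distrC s) ger0_norm ?subr_ge0// -/r => h.
  by rewrite lerXn2r// nnegrE ?addr_ge0 ?mulr_ge0 ?subr_ge0.
rewrite (sqnormB hdot) dotZl dotZr (dot_polar hdot) !normrZ !exprMn.
rewrite !real_normK ?num_real//.
set A := `|f (s *: x)| ^+ 2 in hA *; set B := `|f (t *: x)| ^+ 2 in hB *.
set D := `|f (s *: x) - f (t *: x)| ^+ 2 in hD *.
have p0 : 0 < s^-1 by rewrite invr_gt0.
have q0 : 0 < t^-1 by rewrite invr_gt0.
have pq : 0 <= s^-1 - t^-1 by rewrite subr_ge0 lef_pV2.
have p1 : s^-1 <= 1 by rewrite invf_le1.
have -> : s^-1 ^+ 2 * A - 2 * (s^-1 * (t^-1 * ((A + B - D) / 2)))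
    + t^-1 ^+ 2 * B
  = s^-1 * (s^-1 - t^-1) * A - t^-1 * (s^-1 - t^-1) * B + s^-1 * t^-1 * D.
  by field; rewrite !gt_eqF.
apply: (@le_trans _ _ (s^-1 * (s^-1 - t^-1) * (s * r + eps) ^+ 2
   - t^-1 * (s^-1 - t^-1) * ((t * r) ^+ 2 - 2 * (t * r) * eps)
   + s^-1 * t^-1 * ((t - s) * r + eps) ^+ 2)).
  apply: lerD; first apply: lerB.
  - by apply: ler_wpM2l => //; rewrite mulr_ge0// ltW.
  - by apply: ler_wpM2l => //; rewrite mulr_ge0// ltW.
  - by apply: ler_wpM2l => //; rewrite mulr_ge0// ltW.
have -> : s^-1 * (s^-1 - t^-1) * (s * r + eps) ^+ 2
   - t^-1 * (s^-1 - t^-1) * ((t * r) ^+ 2 - 2 * (t * r) * eps)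
   + s^-1 * t^-1 * ((t - s) * r + eps) ^+ 2
  = (s^-1 - t^-1) * (6 * eps * r) + eps ^+ 2 * s^-1 * s^-1.
  by field; rewrite !gt_eqF.
rewrite [X in _ <= X]mulrDl; apply: lerD.
  rewrite mulrC; apply: ler_wpM2l; first by rewrite !mulr_ge0.
  by rewrite gerBl ltW.
by apply: ler_piMr => //; rewrite mulr_ge0 ?sqr_ge0// ltW.
Qed.

Lemma nearisometry_asymptotic_cone {R : realType}
    {E : normedModType R} {F : completeNormedModType R}
    {dot : {dot F for idfun}} (hdot : induces_norm dot) (eps : R)
    (f : E -> F) :
  0 <= eps -> nearisometry eps f -> f 0 = 0 ->
  exists T : {linear E -> F}, isometric_map T /\
    forall x, harmonic n *: f (n.+1%:R *: x) @[n --> \oo] --> T x.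
Proof.
move=> e0 hf f0; pose u x n : F := harmonic n *: f (n.+1%:R *: x).
have uT x : u x @ \oo --> lim (u x @ \oo).
  apply: (cvgn_sqnorm_bound _ (6 * eps * `|x| + eps ^+ 2)) => n m nm.
  by apply: (nearisometry_sqnorm_scale hdot) => //; rewrite ?ler1n// ler_nat.
pose g x := lim (u x @ \oo).
have gi : isometric_map g.
  move=> x y.
  have guv : `|u x n - u y n| @[n --> \oo] --> `|g x - g y|.
    by apply: cvg_norm; apply: cvgB.
  have hn n : n.+1%:R * harmonic n = 1 :> R by rewrite /= divff.
  have ub : `|x - y| + eps * harmonic n @[n --> \oo] --> `|x - y|.
    rewrite -[X in _ --> X]addr0 -[X in _ --> _ + X](mulr0 eps).
    by apply: cvgD; [exact: cvg_cst|apply: cvgMr; exact: cvg_harmonic].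
  have lb : `|x - y| - eps * harmonic n @[n --> \oo] --> `|x - y|.
    rewrite -[X in _ --> X]subr0 -[X in _ --> _ - X](mulr0 eps).
    by apply: cvgB; [exact: cvg_cst|apply: cvgMr; exact: cvg_harmonic].
  apply: (cvg_unique _ guv) => //; apply: squeeze_cvgr lb ub.
  apply: nearW => n; have h0 : 0 < harmonic n :> R := harmonic_gt0 _.
  rewrite /u -scalerBr normrZ gtr0_norm//.
  have := hf (n.+1%:R *: x) (n.+1%:R *: y).
  rewrite -scalerBr normrZ gtr0_norm// => -[l1 l2].
  have -> : `|x - y| = harmonic n * (n.+1%:R * `|x - y|).
    by rewrite mulrA [harmonic n * _]mulrC hn mul1r.
  rewrite (mulrC eps) -mulrBr -mulrDr.
  by rewrite !ler_wpM2l// ltW.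
have g0 : g 0 = 0.
  apply/cvg_lim => //; rewrite /u.
  under eq_fun do rewrite scaler0 f0 scaler0.
  exact: cvg_cst.
pose lT := GRing.isLinear.Build R E F *:%R g (isometric_map_linear hdot _ gi g0).
pose T : {linear E -> F} := HB.pack g lT.
by exists T.
Qed.

(** * Comparing a nearisometry with its linear isometry *)

(** Both sides of the inequality are seen from infinity in the direction [T u]:
the Busemann limits of [f (n u)] at [f x] and of [T (n u)] at [T x] differ by
at most [2 * eps], one [eps] for each of the two distances involved. *)
Lemma dot_asymptotic_cone_defect {R : realType} {E F : normedModType R}
    {dot : {dot F for idfun}} (hdot : induces_norm dot) (eps : R)
    (f : E -> F) (T : {linear E -> F}) :
  nearisometry eps f -> f 0 = 0 -> isometric_map T ->
  (forall x, harmonic n *: f (n.+1%:R *: x) @[n --> \oo] --> T x) ->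
  forall x u, `|dot (f x - T x) (T u)| <= 2 * eps * `|u|.
Proof.
move=> hf f0 hT fT x u.
have Tn := isometric_map_norm _ hT (raddf0 T).
have [->|u0] := eqVneq u 0.
  by rewrite raddf0 -(scale0r (T u)) dotZr mul0r !normr0 mulr0.
have Tu0 : T u != 0 by rewrite -normr_eq0 Tn normr_eq0.
have cf := cvg_busemann hdot _ _ (f x) Tu0 (fT u).
have TT : harmonic n *: T (n.+1%:R *: u) @[n --> \oo] --> T u.
  have -> : (fun n => harmonic n *: T (n.+1%:R *: u)) = (fun=> T u).
    by apply/funext => n; rewrite linearZ scalerA mulVf// scale1r.
  exact: cvg_cst.
have cT := cvg_busemann hdot _ _ (T x) Tu0 TT.
rewrite -ler_pdivrMr ?normr_gt0// -[`|u|]ger0_norm// -normf_div -Tn.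
rewrite dotBl mulrBl -!(dotC (T u)).
apply: (cvgr_to_le (cvg_norm (cvgB cf cT))).
apply: nearW => n /=.
have [l1 l2] := hf (n.+1%:R *: u) x.
have [l3 l4] := hf (n.+1%:R *: u) 0.
move: l3 l4; rewrite f0 !subr0 => l3 l4.
change (`|(`|f (n.+1%:R *: u)| - `|f (n.+1%:R *: u) - f x|)
  - (`|T (n.+1%:R *: u)| - `|T (n.+1%:R *: u) - T x|)| <= 2 * eps).
by rewrite hT Tn ler_norml; lra.
Qed.

(** A minimizing sequence for [|y - T x|] is Cauchy by the parallelogram identity
and converges in [E], [T] being isometric and [E] complete; minimality of the
limit gives the orthogonality by a first variation along [T v]. *)
Lemma isometric_range_projection {R : realType} {E : completeNormedModType R}
    {F : normedModType R} {dot : {dot F for idfun}} (hdot : induces_norm dot)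
    (T : {linear E -> F}) (y : F) :
  isometric_map T -> exists x, forall u, dot (y - T x) (T u) = 0.
Proof.
move=> hT; pose q x := `|y - T x| ^+ 2; pose d := inf (range q).
have infq : has_inf (range q).
  by split; [exists (q 0), 0|exists 0 => _ [x _ <-]; exact: sqr_ge0].
have dq x : d <= q x by apply: ge_inf; [case: infq|exists x].
have /choice[u uq] n : exists x, q x < d + harmonic n.
  have [_ [x _ <-] qx] := inf_adherent (@harmonic_gt0 R n) infq.
  by exists x.
have cu : cvgn u.
  apply: (cvgn_sqnorm_bound _ 4) => n m nm.
  have mid : 4 * d <= `|(y - T (u m)) + (y - T (u n))| ^+ 2.
    have -> : (y - T (u m)) + (y - T (u n))
        = 2 *: (y - T (2^-1 *: (u m + u n))).
      rewrite linearZ linearD scalerBr scalerA divff// scale1r.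
      by rewrite scaler_nat mulr2n opprD addrACA.
    have four : 2 ^+ 2 = 4 :> R by ring.
    rewrite normrZ exprMn ger0_norm// four ler_pM2l//; exact: dq.
  have hmn : harmonic m <= harmonic n :> R.
    by rewrite /= lef_pV2 ?posrE// ler_nat.
  have := uq n; have := uq m; rewrite /q => qm qn.
  have -> : `|u n - u m| = `|(y - T (u m)) - (y - T (u n))|.
    by rewrite -hT opprB (addrC (y - _)) addrA subrK.
  move: mid; rewrite (sqnormB hdot) (sqnormD hdot); lra.
pose x := lim (u @ \oo); have ux : u @ \oo --> x by exact: cu.
have qx : q x <= d.
  have Tux : T (u n) @[n --> \oo] --> T x.
    apply/cvgrPdist_le => e e0; near=> n; rewrite hT.
    by near: n; move/cvgrPdist_le: ux; exact.
  have qn : q (u n) @[n --> \oo] --> q x.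
    rewrite /q; rewrite expr2; under eq_fun do rewrite expr2.
    by apply: cvgM; apply: cvg_norm; apply: cvgB => //; exact: cvg_cst.
  have dn : d + harmonic n @[n --> \oo] --> d.
    rewrite -[X in _ --> X]addr0.
    by apply: cvgD; [exact: cvg_cst|exact: cvg_harmonic].
  by apply: (ler_cvg_to qn dn); apply: nearW => n; exact: ltW.
exists x => v; set w := y - T x; set c := dot w (T v); set V := `|T v| ^+ 2.
have var t : 0 <= t * (t * V - 2 * c).
  have := dq (x + t *: v).
  rewrite /q linearD linearZ opprD addrA -/w => /(le_trans qx).
  rewrite (sqnormB hdot) dotZr normrZ exprMn real_normK ?num_real//.
  rewrite -/c -/V /q -/w; lra.
apply/eqP/negPn/negP => c0.
have V0 : 0 <= V by exact: sqr_ge0.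
(* The minimum of the variation is at [c / V]; adding [1] avoids the case
   [V = 0] and still gives a negative value. *)
have := var (c / (V + 1)); apply/negP; rewrite -ltNge.
have -> : c / (V + 1) * (c / (V + 1) * V - 2 * c)
  = - ((c / (V + 1)) ^+ 2 * (V + 2)) by field; rewrite gt_eqF// ltr_wpDl.
rewrite oppr_lt0 mulr_gt0 ?ltr_wpDl// exprn_even_gt0//=.
by rewrite mulf_neq0// invr_neq0// gt_eqF// ltr_wpDl.
Unshelve. all: by end_near.
Qed.

Lemma projection_defect {R : realType} {E F : normedModType R}
    {dot : {dot F for idfun}} (hdot : induces_norm dot)
    (T : {linear E -> F}) (C : R) (y : F) (x z : E) :
  0 <= C -> isometric_map T ->
  (forall u, `|dot (y - T x) (T u)| <= C * `|u|) ->
  (forall u, dot (y - T z) (T u) = 0) ->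
  `|T x - T z| <= C.
Proof.
move=> C0 hT defect orth.
have Tn := isometric_map_norm _ hT (raddf0 T).
set w := T x - T z.
have wE : w = T (x - z) by rewrite raddfB.
have [->|w0] := eqVneq w 0; first by rewrite normr0.
rewrite -(@ler_pM2r _ `|w|) ?normr_gt0// -expr2 hdot.
have -> : dot w w = dot (y - T z) w - dot (y - T x) w.
  by rewrite -dotBl opprB addrC addrA subrK.
rewrite wE orth sub0r Tn; apply: le_trans (defect _).
by rewrite -normrN ler_norm.
Qed.

(** * Surjectivity in equal finite dimensions *)

Lemma has_dim_injective_surjective {R : realType} {V W : lmodType R} (n : nat)
    (T : {linear V -> W}) :
  has_dim V n -> has_dim W n -> injective T -> surjective T.
Proof.
move=> [b [bfree _]] [c [_ cspan]] Tinj y.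
have /choice[a aE] i := cspan (T (b i)).
(* Row [i] of [A] holds the coordinates of [T (b i)] in [c]. *)
pose A := \matrix_(i < n, j < n) a i j.
have TA (v : 'rV_n) :
    T (\sum_i v 0 i *: b i) = \sum_j (v *m A) 0 j *: c j.
  rewrite linear_sum; under eq_bigr => i _ do rewrite linearZ_LR /= aE scaler_sumr.
  rewrite exchange_big /=; apply: eq_bigr => j _.
  rewrite mxE scaler_suml; apply: eq_bigr => i _.
  by rewrite !mxE scalerA.
have Afree : row_free A.
  apply: inj_row_free => v vA; apply/rowP => i; rewrite mxE.
  apply: (bfree (fun i => v 0 i)); apply: Tinj.
  by rewrite TA vA raddf0 big1// => j _; rewrite mxE scale0r.
have [d ->] := cspan y.
exists (\sum_i (\row_j d j *m invmx A) 0 i *: b i).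
rewrite TA mulmxKV -?row_free_unit//.
by apply: eq_bigr => j _; rewrite mxE.
Qed.

(** * The induced Hilbert space structure and the theorem *)

Lemma isomorphic_to_hilbert_isometric {R : realType}
    {E : completeNormedModType R} {F : normedModType R}
    {dot : {dot F for idfun}} (hdot : induces_norm dot)
    (T : {linear E -> F}) :
  isometric_map T -> isomorphic_to_hilbert E.
Proof.
move=> hT.
have Tn := isometric_map_norm _ hT (raddf0 T).
pose op (x y : E) : R := dot (T x) (T y).
have opl y : zmod_morphism (op^~ y).
  by move=> u v; rewrite /op raddfB dotBl.
have opC x y : op x y = op y x by exact: dotC.
have opr x : zmod_morphism (op x) by move=> u v; rewrite !(opC x) opl.
have opZl y : scalable_for *%R (op^~ y).
  by move=> k u; rewrite /op linearZ dotZl.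
have opZr x : scalable_for (idfun \; *%R) (op x).
  by move=> k u; rewrite !(opC x) opZl.
have herm x y : op x y = (-1) ^+ false * idfun (op y x).
  by rewrite expr0 mul1r opC.
have pos u : u != 0 -> 0 < op u u.
  by move=> u0; rewrite /op -hdot Tn exprn_gt0// normr_gt0.
pose bil := isBilinear.Build R E E R *%R (idfun \; *%R) op opl opr opZl opZr.
pose hrm := isHermitianSesquilinear.Build R E false idfun op herm.
pose dp := isDotProduct.Build R E op pos.
pose dotE : {dot E for idfun} := HB.pack op bil hrm dp.
exists E, dotE, (idfun : {linear E -> E}); split.
- by move=> x; rewrite /= /op -hdot Tn.
- by move=> x y.
- by exists id.
Qed.

Theorem mainTheorem4 (R : realType) (E F : completeNormedModType R)
    (dot : {dot F for idfun}) (hdot : induces_norm dot)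
    (eps : R) (heps : 0 <= eps) (f : E -> F)
    (hf : nearisometry eps f) (f0 : f 0 = 0) :
  (exists T : {linear E -> F},
     [/\ isometric_map T,
         exists P : F -> F,
           orthogonal_projection dot (range T) P /\
           (ereal_sup [set (`|T x - P (f x)|)%:E | x in [set: E]]
              <= (2 * eps)%:E)%E
       & surjective f \/ (exists n : nat, has_dim E n /\ has_dim F n) ->
         surjective T /\
         (ereal_sup [set (`|T x - f x|)%:E | x in [set: E]]
            <= (2 * eps)%:E)%E]) /\
  isomorphic_to_hilbert E.
Proof.
have [T [hT fT]] := nearisometry_asymptotic_cone hdot eps f heps hf f0.
have Tn := isometric_map_norm _ hT (raddf0 T).
have defect := dot_asymptotic_cone_defect hdot eps f T hf f0 hT fT.
have /choice[p pT] y := isometric_range_projection hdot T y hT.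
have close x : `|T x - T (p (f x))| <= 2 * eps.
  apply: (projection_defect hdot T _ (f x) _ _ _ hT (defect x) (pT _)).
  by rewrite mulr_ge0.
split; last exact: isomorphic_to_hilbert_isometric hdot T hT.
exists T; split => //.
  exists (T \o p); split.
    by move=> y; split; [exists (p y)|move=> _ [u _ <-]; exact: pT].
  by apply: ge_ereal_sup => _ [x _ <-]; rewrite lee_fin; exact: close.
move=> dims.
have Tsurj : surjective T.
  case: dims => [fsurj y|[n [En Fn]]]; last first.
    apply: has_dim_injective_surjective En Fn _ => x y Txy.
    by apply/eqP; rewrite -subr_eq0 -normr_eq0 -hT Txy subrr normr0.
  exists (p y); apply/eqP/negPn/negP.
  rewrite eq_sym -subr_eq0 -normr_gt0; set v := y - _ => v0.
  have vT u : dot v (T u) = 0 by exact: pT.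
  (* The least integer strictly above [3 * eps / |v|] makes [n |v| <= 3 * eps] fail. *)
  pose N := Num.truncn ((3 * eps) / `|v|).
  have [x fx] := fsurj (N.+1%:R *: v).
  have Tpx : T (p (f x)) = 0.
    apply/eqP; rewrite -normr_eq0 -sqrf_eq0 hdot.
    have := pT (f x) (p (f x)); rewrite dotBl fx dotZl vT mulr0 sub0r.
    by move/eqP; rewrite oppr_eq0.
  have := close x; rewrite Tpx subr0 Tn => xe.
  have [_] := hf x 0; rewrite f0 !subr0 fx normrZ ger0_norm// => fe.
  have : N.+1%:R * `|v| <= 3 * eps by lra.
  by rewrite -ler_pdivlMr// leNgt truncnS_gt.
split=> //; apply: ge_ereal_sup => _ [x _ <-]; rewrite lee_fin.
have := close x; have [u Tu] := Tsurj (f x - T (p (f x))).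
suff : f x - T (p (f x)) = 0 by move/eqP; rewrite subr_eq0 => /eqP <-.
apply/eqP; rewrite -normr_eq0 -sqrf_eq0 hdot.
by rewrite -[X in dot _ X]Tu pT.
Qed.
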